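(* Let $\gamma,\delta\in(0,1)$, let $R$ be a valid ratio defined on a probability space $(\Omega,\mathcal{F},P)$, and let $\tilde R$ be the $(\gamma,\delta)$-discretization of $R$. Then $\mathrm{ext}(R,\tilde R)\le\gamma+\delta\, TV(R)$.
   Context: A valid ratio on a probability space $(\Omega,\mathcal{F},Q)$ is a non-negative random variable $R$ with $\mathbb{E}[R]\le 1$. For valid ratios $R_1$ on $(\Omega_1,\mathcal{F}_1,Q_1)$ and $R_2$ on $(\Omega_2,\mathcal{F}_2,Q_2)$, the independent product $R_1\circ R_2$ is the valid ratio on $(\Omega_1\times\Omega_2,\mathcal{F}_1\times\mathcal{F}_2,Q_1\times Q_2)$ given by $(R_1\circ R_2)(\omega_1,\omega_2)=R_1(\omega_1)R_2(\omega_2)$. For a valid ratio $R$, $TV(R)\defeq\mathbb{E}[(1-R)_+]$ where $x_+=\max\{x,0\}$ (this depends only on the distribution of $R$). The extension distance between valid ratios $R_1,R_2$ is $\mathrm{ext}(R_1,R_2)=\sup_S|TV(S\circ R_1)-TV(S\circ R_2)|$, the supremum over all valid ratios $S$ (on arbitrary probability spaces). $(\gamma,\delta)$-partition: let $m=1+\lceil\ln(1/\gamma)/\ln(1+\delta)\rceil$, $a_0=1$, $a_m=0$, $a_k=1-(1+\delta)^{k-1}\gamma$ for $1\le k<m$; $I_0=\{1\}$, $I_k=[a_k,a_{k-1})$ for $1\le k\le m$, $J_k=(1/a_{k-1},1/a_k]$ for $1\le k<m$, $J_m=(1/a_{m-1},\infty)$. The collection $\mathcal{I}_{\gamma,\delta}=\{I_0,I_1,\dots,I_m,J_1,\dots,J_m\}$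 partitions $[0,\infty)$, and $\mathcal{I}_{\gamma,\delta}(x)$ denotes the unique interval containing $x\ge 0$. The $(\gamma,\delta)$-discretization of a valid ratio $R$ is $\tilde R=\mathbb{E}[R\mid\sigma(\mathcal{I}_{\gamma,\delta}(R))]$. *)

(* Defs.v *)
From HB Require Import structures.
From mathcomp Require Import all_boot all_order all_algebra.
From mathcomp Require Import all_classical all_reals all_analysis.

Set Implicit Arguments.
Unset Strict Implicit.
Unset Printing Implicit Defensive.

Import Order.TTheory GRing.Theory Num.Theory.
Import numFieldNormedType.Exports.

Local Open Scope classical_set_scope.
Local Open Scope ring_scope.

Definition valid_ratio (R : realType) (d : measure_display)
    (T : measurableType d) (P : probability T R) (X : T -> R) : Prop :=
  [/\ measurable_fun [set: T] X, (forall w, 0 <= X w) & ('E_P[X] <= 1)%E].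

Definition indep_prod (R : realType) (T1 T2 : Type) (X1 : T1 -> R)
    (X2 : T2 -> R) : T1 * T2 -> R :=
  fun w => X1 w.1 * X2 w.2.

Definition TV (R : realType) (d : measure_display) (T : measurableType d)
    (P : probability T R) (X : T -> R) : \bar R :=
  'E_P[(fun w => Num.max (1 - X w) 0)%R]%E.

(* The values of |TV (S o X1) - TV (S o X2)| as S ranges over the valid ratios
   on all probability spaces. *)
Definition ext_gaps (R : realType)
    (d1 : measure_display) (T1 : measurableType d1) (P1 : probability T1 R)
    (X1 : T1 -> R)
    (d2 : measure_display) (T2 : measurableType d2) (P2 : probability T2 R)
    (X2 : T2 -> R) : set (\bar R) :=
  [set e | exists (d : measure_display) (T : measurableType d)
             (Q : probability T R) (S : T -> R),
             valid_ratio Q S /\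
             e = `| TV (Q \x P1)%E (indep_prod S X1)
                    - TV (Q \x P2)%E (indep_prod S X2) |%E].

Definition ext (R : realType)
    (d1 : measure_display) (T1 : measurableType d1) (P1 : probability T1 R)
    (X1 : T1 -> R)
    (d2 : measure_display) (T2 : measurableType d2) (P2 : probability T2 R)
    (X2 : T2 -> R) : \bar R :=
  ereal_sup (ext_gaps P1 X1 P2 X2).

Section partition.
Variables (R : realType) (gamma delta : R).

(* For gamma and delta in (0, 1) the ceiling is positive, so that the absolute
   value only converts it from int to nat. *)
Definition part_size : nat :=
  (1 + absz (Num.ceil (ln (1 / gamma) / ln (1 + delta))%R))%N.

Definition part_pt (k : nat) : R :=
  if k == 0%N then 1
  else if (k < part_size)%N then 1 - (1 + delta) ^+ k.-1 * gamma
  else 0.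

Definition part_I (k : nat) : set R :=
  if k == 0%N then [set 1] else `[part_pt k, part_pt k.-1[%classic.

Definition part_J (k : nat) : set R :=
  if (k < part_size)%N then `](1 / part_pt k.-1), (1 / part_pt k)]%classic
  else `](1 / part_pt k.-1), +oo[%classic.

Definition part : set (set R) :=
  [set part_I k | k in [set k | (k <= part_size)%N]] `|`
  [set part_J k | k in [set k | (1 <= k <= part_size)%N]].

(* The member of part containing x; the default value set0 is only taken for
   x < 0. *)
Definition part_cell (x : R) : set R :=
  xget set0 [set A | part A /\ A x].

End partition.

(* The sigma-algebra generated by a function f taking finitely many values,
   its codomain being equipped with the discrete sigma-algebra. *)
Definition sigma_discrete (T U : Type) (f : T -> U) : set (set T) :=
  preimage_set_system [set: T] f [set: set U].

(* Y is a version of the conditional expectation E[X | G]; this determines Y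
   only up to almost sure equality. *)
Definition is_cond_expectation (R : realType) (d : measure_display)
    (T : measurableType d) (P : probability T R) (G : set (set T))
    (X Y : T -> R) : Prop :=
  [/\ preimage_set_system [set: T] Y measurable `<=` G,
      P.-integrable [set: T] (EFin \o Y) &
      forall A, G A ->
        (\int[P]_(w in A) (Y w)%:E = \int[P]_(w in A) (X w)%:E)%E].

Definition is_discretization (R : realType) (gamma delta : R)
    (d : measure_display) (T : measurableType d) (P : probability T R)
    (X Y : T -> R) : Prop :=
  is_cond_expectation P
    (sigma_discrete (fun w => part_cell gamma delta (X w))) X Y.

(* Main.v *)
Require Import Defs.
From HB Require Import structures.
From mathcomp Require Import all_boot all_order all_algebra.
From mathcomp Require Import all_classical all_reals all_analysis.
From mathcomp Require Import measurable_realfun ring lra.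

(** Fix [s >= 0] and compare the expectations of [(1 - s R)_+] and
    [(1 - s R~)_+] cell by cell.  As [y_+ = (y + |y|) / 2] and [R], [R~] have
    the same mean on each cell, only [|1 - s R|] and [|1 - s R~|] matter.  On a
    cell below [1], of width [c], they differ by at most [s c].  On a cell above
    [1] write [|1 - s R| = R |1 / R - s|] and replace [|1 - s R~|] by
    [(R / R~) |1 - s R~|], which has the same mean; now the difference is at
    most [c R], where [c] bounds the differences of inverses in the cell.  The
    partition is chosen such that [c <= gamma + delta (1 - x)] for [x] in a cell
    below [1] and [c <= gamma + delta (1 - 1 / x)] for [x] in a cell above [1].
    Since [E[R] <= 1] gives [E[(R - 1)_+] <= TV(R)], summing over the cells
    bounds the gap by [(s + 1) / 2 * (gamma + delta TV(R))].  Integrating in [s]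
    over the law of [S], with [E[S] <= 1], concludes. *)

Set Implicit Arguments.
Unset Strict Implicit.
Unset Printing Implicit Defensive.

Import Order.TTheory GRing.Theory Num.Theory.
Import numFieldNormedType.Exports.

Local Open Scope classical_set_scope.
Local Open Scope ring_scope.

(** * Breakpoints, cells and widths of the partition *)

Section partition.
Context (R : realType) (gamma delta : R).
Hypotheses (hgamma : 0 < gamma < 1) (hdelta : 0 < delta < 1).

Local Notation m := (part_size gamma delta).
Local Notation pt := (part_pt gamma delta).

(** Take logarithms: [m.-1] is the ceiling of [ln (1 / gamma) / ln (1 + delta)]. This is what keeps
    the breakpoints before index [m] positive and the last step short. *)
Lemma exprn_part_size_lt k : (k < m.-1)%N = ((1 + delta) ^+ k * gamma < 1).
Proof.
have [/andP[g0 g1] /andP[d0 d1]] := (hgamma, hdelta).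
have lnd : 0 < ln (1 + delta) by rewrite ln_gt0// ltrDl.
have lng : 0 < ln (1 / gamma) by rewrite ln_gt0// div1r invf_gt1.
rewrite /part_size add1n /= -ltz_nat gez0_abs; last first.
  by rewrite ceil_ge0 (lt_trans _ (divr_gt0 lng lnd))// ltrN10.
have d1' : 0 < 1 + delta by rewrite ltr_wpDr// ltW.
rewrite -[RHS]ltr_pdivlMr// -[RHS]ltr_ln ?posrE ?exprn_gt0// ?divr_gt0//.
by rewrite lnXn// ceil_gt_int ltr_pdivlMr// -mulr_natl.
Qed.

Lemma part_size_gt1 : (1 < m)%N.
Proof.
have : (0 < m.-1)%N by rewrite exprn_part_size_lt expr0 mul1r; case/andP: hgamma.
by case: (m) => [//|[]].
Qed.

Lemma part_pt0 : pt 0 = 1.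
Proof. by []. Qed.

Lemma part_ptE k : (0 < k < m)%N -> pt k = 1 - (1 + delta) ^+ k.-1 * gamma.
Proof. by case: k => // k /= km; rewrite /part_pt /= km. Qed.

Lemma part_pt_size k : (m <= k)%N -> pt k = 0.
Proof.
move=> mk; rewrite /part_pt ltnNge mk /=.
by case: k mk => //; rewrite leqn0 => /eqP m0; have := part_size_gt1; rewrite m0.
Qed.

Lemma part_pt_gt0 k : (k < m)%N -> 0 < pt k.
Proof.
case: k => [|k] km; first by rewrite part_pt0.
rewrite part_ptE//= subr_gt0 -exprn_part_size_lt.
by have := part_size_gt1; case: (m) km.
Qed.

Lemma part_pt_ge0 k : 0 <= pt k.
Proof.
by have [/part_pt_gt0/ltW//|/part_pt_size ->] := ltnP k m.
Qed.

(** The distance [1 - pt k] starts at [gamma] for [k = 1] and is then multiplied by [1 + delta], so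
    it grows by [delta] times itself at each step. *)
Lemma part_pt_step k :
  0 <= pt k - pt k.+1 <= (if k == 0%N then gamma else delta * (1 - pt k)).
Proof.
have [/andP[g0 g1] /andP[d0 d1]] := (hgamma, hdelta).
case: k => [|k].
  rewrite part_pt0 part_ptE ?part_size_gt1//= expr0 mul1r; lra.
have [km|mk] := ltnP k.+1 m; last first.
  rewrite !part_pt_size ?(leq_trans mk)//=; lra.
have g1' : pt k.+1 = 1 - (1 + delta) ^+ k * gamma by rewrite part_ptE.
have e0 : 0 < (1 + delta) ^+ k by rewrite exprn_gt0//; lra.
have dg0 : 0 < delta * ((1 + delta) ^+ k * gamma) by rewrite !mulr_gt0.
have [km'|mk] := ltnP k.+2 m.
  rewrite [pt k.+2]part_ptE//= g1' exprS; apply/andP; split; lra.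
(* Here [m = k.+2] and the breakpoint is set to 0. The geometric formula would give a value at most
   0, so this last step is only shortened. *)
rewrite [pt k.+2]part_pt_size//= subr0 part_pt_ge0 /=.
have : ~~ (k.+1 < m.-1)%N by rewrite -leqNgt; case: (m) mk.
by rewrite exprn_part_size_lt -leNgt exprS => h; rewrite g1'; lra.
Qed.

Lemma part_pt_nincr : {homo pt : k l / (k <= l)%N >-> l <= k}.
Proof.
by apply: homo_leq => [//|k l n /[swap]|k]; [exact: le_trans|];
  case/andP: (part_pt_step k); rewrite subr_ge0.
Qed.

Lemma part_pt_le1 k : pt k <= 1.
Proof. by rewrite -part_pt0 part_pt_nincr. Qed.

Lemma part_pt_width k : pt k - pt k.+1 <= gamma + delta * (1 - pt k).
Proof.
have [/andP[g0 g1] /andP[d0 d1]] := (hgamma, hdelta).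
have /andP[_] := part_pt_step k; case: ifP => [/eqP -> |_] h.
  by rewrite part_pt0 subrr mulr0 addr0.
by apply: le_trans h _; rewrite lerDr ltW.
Qed.

Lemma part_pt_bracket y : 0 <= y < 1 ->
  exists2 k, (k < m)%N & pt k.+1 <= y < pt k.
Proof.
move=> /andP[y0 y1].
have ex : exists k, pt k <= y by exists m; rewrite part_pt_size.
(* The least index whose breakpoint is at most [y] is the lower end of the bracket; it is not 0, as
   [y < 1]. *)
have := ex_minnP ex => -[[|k]] pk kmin.
  by move: pk; rewrite part_pt0 leNgt y1.
have ky : y < pt k by rewrite ltNge; apply/negP => /kmin; rewrite ltnn.
exists k; last by rewrite pk.
by rewrite ltnNge; apply/negP => /part_pt_size k0; move: ky; rewrite k0 ltNge y0.
Qed.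

Lemma part_IS k x : part_I gamma delta k.+1 x <-> pt k.+1 <= x < pt k.
Proof. by rewrite /part_I /= in_itv. Qed.

(* This includes the unbounded [J_m], since [pt m = 0]. *)
Lemma part_JS k x : (k < m)%N ->
  part_J gamma delta k.+1 x <-> 0 < x /\ pt k.+1 <= x^-1 < pt k.
Proof.
move=> km; have pk := part_pt_gt0 km.
rewrite /part_J !div1r; have [km'|mk] := ltnP k.+1 m.
  rewrite /= in_itv /=; have pk' := part_pt_gt0 km'.
  split=> [/andP[h1 h2]|[x0 /andP[h1 h2]]].
    have x0 : 0 < x by rewrite (lt_trans _ h1)// invr_gt0.
    by split=> //; rewrite -[X in X <= _]invrK lef_pV2 ?posrE ?invr_gt0// h2
      -[X in _ < X]invrK ltf_pV2 ?posrE ?invr_gt0.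
  by rewrite -[X in _ < X]invrK ltf_pV2 ?posrE ?invr_gt0// h2
      -[X in X <= _]invrK lef_pV2 ?posrE ?invr_gt0.
rewrite /= in_itv /= andbT [pt k.+1]part_pt_size//.
split=> [h1|[x0 /andP[h1 h2]]].
  have x0 : 0 < x by rewrite (lt_trans _ h1)// invr_gt0.
  by split=> //; rewrite invr_ge0 ltW//= -[X in _ < X]invrK ltf_pV2 ?posrE ?invr_gt0.
by rewrite -[X in _ < X]invrK ltf_pV2 ?posrE ?invr_gt0.
Qed.

Lemma part_pt_bracket_inj k l (y : R) :
  pt k.+1 <= y < pt k -> pt l.+1 <= y < pt l -> k = l.
Proof.
move=> /andP[k1 k2] /andP[l1 l2].
have [kl|lk|//] := ltngtP k l.
  by have := le_lt_trans k1 l2; rewrite ltNge part_pt_nincr.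
by have := le_lt_trans l1 k2; rewrite ltNge part_pt_nincr.
Qed.

Lemma partP A : part gamma delta A ->
  [\/ A = [set 1],
      exists k, A = part_I gamma delta k.+1 |
      exists2 k, (k < m)%N & A = part_J gamma delta k.+1].
Proof.
case=> [[[|k] /= km <-]|[[//|k] /= km <-]]; [exact: Or31|apply: Or32|apply: Or33].
  by exists k.
by exists k.
Qed.

Lemma part_cover x : 0 <= x -> exists A, part gamma delta A /\ A x.
Proof.
move=> x0; have [x1|x1|->] := ltgtP x 1.
- have [|k km kx] := @part_pt_bracket x; first by rewrite x0.
  exists (part_I gamma delta k.+1); split; last exact/part_IS.
  by left; exists k.+1.
- have x_gt0 : 0 < x := lt_trans ltr01 x1.
  have [|k km kx] := @part_pt_bracket x^-1; first by rewrite invr_ge0 x0 invf_lt1.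
  exists (part_J gamma delta k.+1); split; last exact/part_JS.
  by right; exists k.+1.
- by exists [set 1]; split => //; left; exists 0%N.
Qed.

(** Cells of different kinds are separated by the point 1. Within one kind, the brackets around [x],
    or around [x^-1] above 1, must agree. *)
Lemma part_inj A B x : part gamma delta A -> part gamma delta B ->
  A x -> B x -> A = B.
Proof.
have pt1 k : pt k <= 1 := part_pt_le1 k.
have V1 (y : R) : 0 < y -> y^-1 < 1 -> 1 < y.
  by move=> y0; rewrite invf_lt1.
move=> /partP[->|[k ->]|[k km ->]] /partP[->|[l ->]|[l lm ->]] //.
- by move=> /= -> /part_IS/andP[_]; rewrite ltNge pt1.
- by move=> /= -> /part_JS-/(_ lm)[_]/andP[_]; rewrite invr1 ltNge pt1.
- by move=> /part_IS/andP[_] /[swap] -> /=; rewrite ltNge pt1.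
- by move=> /part_IS xk /part_IS xl; rewrite (part_pt_bracket_inj xk xl).
- move=> /part_IS/andP[_ h] /part_JS-/(_ lm)[x0]/andP[_ h'].
  by have := lt_trans (lt_le_trans h (pt1 _)) (V1 _ x0 (lt_le_trans h' (pt1 _))); rewrite ltxx.
- by move=> /part_JS-/(_ km)[_]/andP[_] /[swap] -> /=; rewrite invr1 ltNge pt1.
- move=> /part_JS-/(_ km)[x0]/andP[_ h'] /part_IS/andP[_ h].
  by have := lt_trans (lt_le_trans h (pt1 _)) (V1 _ x0 (lt_le_trans h' (pt1 _))); rewrite ltxx.
- move=> /part_JS-/(_ km)[_ xk] /part_JS-/(_ lm)[_ xl].
  by rewrite (part_pt_bracket_inj xk xl).
Qed.

Lemma part_cellP x A : 0 <= x ->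
  part_cell gamma delta x = A <-> part gamma delta A /\ A x.
Proof.
move=> x0; split=> [<-|[pA Ax]].
  exact: (xgetPex set0 (part_cover x0)).
apply: xget_unique => // B [pB Bx].
exact: part_inj Bx Ax.
Qed.

Lemma measurable_part A : part gamma delta A -> measurable A.
Proof.
by move=> [[k _ <-]|[k _ <-]]; rewrite /part_I /part_J; case: ifP.
Qed.

(** The enumeration over which integrals are split; [undup] makes it duplicate-free without
    comparing cells. *)
Definition part_seq : seq (set R) :=
  undup ([seq part_I gamma delta k | k <- iota 0 m.+1] ++
         [seq part_J gamma delta k | k <- iota 1 m]).

Lemma part_seqP A : part gamma delta A -> A \in part_seq.
Proof.
rewrite mem_undup mem_cat => -[[k km <-]|[k km <-]]; apply/orP; [left|right];
  by apply/map_f; rewrite mem_iota.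
Qed.

End partition.

(* Below 1 the points of a cell are close to each other; above 1 it is their
   inverses that are, as [`|x^-1 - y^-1| <= c] means [`|x - y| <= c * x * y]. *)
Definition fine_cell (R : realType) (gamma delta : R) (A : set R) : Prop :=
  exists c : R,
    (forall x y, A x -> A y -> [/\ x <= 1, c <= gamma + delta * (1 - x) & `|x - y| <= c]) \/
    (forall x y, A x -> A y -> [/\ 1 <= x, c * x <= gamma * x + delta * (x - 1) &
       `|x - y| <= c * x * y]).

(** In both cases [c] is the distance of two consecutive breakpoints. The upper one, [pt k], exceeds
    [x] below 1 and [x^-1] above 1, so [part_pt_width] becomes a bound at the point itself. *)
Lemma part_fine (R : realType) (gamma delta : R) A :
  0 < gamma < 1 -> 0 < delta < 1 -> part gamma delta A ->
  fine_cell gamma delta A.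
Proof.
move=> hg hd; have [/andP[g0 g1] /andP[d0 d1]] := (hg, hd).
move=> /partP[->|[k ->]|[k km ->]].
- exists 0; left => _ _ /= -> ->; rewrite !subrr mulr0 addr0 normr0.
  by split => //; exact: ltW.
- exists (part_pt gamma delta k - part_pt gamma delta k.+1); left.
  have w := part_pt_width hg hd k.
  have p1 := part_pt_le1 hg hd k.
  move=> x y /part_IS/andP[x1 x2] /part_IS/andP[y1 y2]; split; first lra.
    apply: le_trans w _; rewrite lerD2l ler_pM2l//; lra.
  by rewrite ler_norml; lra.
- exists (part_pt gamma delta k - part_pt gamma delta k.+1); right.
  have w := part_pt_width hg hd k.
  have p1 := part_pt_le1 hg hd k.
  move=> x y /part_JS-/(_ hg hd km)[x0 /andP[x1 x2]].
  move=> /part_JS-/(_ hg hd km)[y0 /andP[y1 y2]].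
  split; first by rewrite -invf_le1//; lra.
    have -> : gamma * x + delta * (x - 1) = (gamma + delta * (1 - x^-1)) * x.
      by field; rewrite gt_eqF.
    rewrite ler_pM2r//; apply: le_trans w _; rewrite lerD2l ler_pM2l//; lra.
  have -> : x - y = (y^-1 - x^-1) * (x * y) by field; rewrite !gt_eqF.
  rewrite normrM (ger0_norm (ltW (mulr_gt0 x0 y0))) -mulrA.
  by rewrite ler_pM2r ?mulr_gt0// ler_norml; lra.
Qed.

(** * Pointwise comparison of hinges *)

Definition hinge (R : realType) (s x : R) : R := Num.max (1 - s * x) 0.

Lemma hinge_ge0 (R : realType) (s x : R) : 0 <= hinge s x.
Proof. by rewrite le_max lexx orbT. Qed.

Lemma hingeE (R : realType) (s x : R) :
  hinge s x = (1 - s * x + `|1 - s * x|) / 2.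
Proof.
rewrite /hinge; case: leP => h; first by rewrite ler0_norm// subrr mul0r.
by rewrite gtr0_norm//; field.
Qed.

(** The linear term subtracted has mean zero when [m] is the mean of [x]. What remains is half of
    [|1 - s * x| - |1 - s * m|], bounded by the reverse triangle inequality. *)
Lemma hinge_gap (R : realType) (s x m c : R) : 0 <= s -> `|x - m| <= c ->
  `|hinge s x - hinge s m - - (s / 2) * (x - m)| <= s * c / 2.
Proof.
move=> s0 xm; rewrite !hingeE.
have -> : (1 - s * x + `|1 - s * x|) / 2 - (1 - s * m + `|1 - s * m|) / 2 -
    - (s / 2) * (x - m) = (`|1 - s * x| - `|1 - s * m|) / 2 by field.
rewrite normrM (gtr0_norm (x := 2^-1)) ?invr_gt0// ler_pM2r ?invr_gt0//.
apply: le_trans (ler_dist_dist _ _) _.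
have -> : 1 - s * x - (1 - s * m) = - (s * (x - m)) by ring.
by rewrite normrN normrM (ger0_norm s0) ler_wpM2l.
Qed.

(* [hinge_gap] for inverses: [hinge s x = x * max (x^-1 - s) 0], so that
   [`|1 - s * x|] is compared with [x / m * `|1 - s * m|]. *)
Lemma hinge_gap_inv (R : realType) (s x m c : R) :
  0 <= x -> 0 < m -> `|x - m| <= c * x * m ->
  `|hinge s x - hinge s m - (`|1 - s * m| / m - s) / 2 * (x - m)| <= c * x / 2.
Proof.
move=> x0 m0 xm; rewrite !hingeE.
have -> : (1 - s * x + `|1 - s * x|) / 2 - (1 - s * m + `|1 - s * m|) / 2 -
    (`|1 - s * m| / m - s) / 2 * (x - m) =
    (`|1 - s * x| - x / m * `|1 - s * m|) / 2 by field; rewrite gt_eqF.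
rewrite normrM (gtr0_norm (x := 2^-1)) ?invr_gt0// ler_pM2r ?invr_gt0//.
have xm0 : 0 <= x / m by rewrite divr_ge0// ltW.
rewrite -{1}(ger0_norm xm0) -normrM.
apply: le_trans (ler_dist_dist _ _) _.
have -> : 1 - s * x - x / m * (1 - s * m) = - ((x - m) / m).
  by field; rewrite gt_eqF.
by rewrite normrN normrM (gtr0_norm (x := m^-1)) ?invr_gt0// ler_pdivrMr.
Qed.

(* Twice a bound on the gap at [x]: the first summand serves the cells below 1,
   the second one, where [hinge 1 x + (x - 1) = max (x - 1) 0], those above 1. *)
Definition gap_bound (R : realType) (gamma delta s x : R) : R :=
  s * (gamma + delta * hinge 1 x) +
  (gamma * x + delta * (hinge 1 x + (x - 1))).

(** * One cell against its mean value *)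

Section cell.
Context (R : realType) (d : measure_display) (T : measurableType d)
  (P : probability T R) (W : set T) (X : T -> R) (m : R).
Hypotheses (mW : measurable W) (iX : P.-integrable W (EFin \o X))
  (W0 : 0 < fine (P W)) (mE : \int[P]_(w in W) X w = m * fine (P W)).

(** Averaging over [W] carries an affine inequality from the values of [X] to their mean, so bounds
    on pairs of points of a cell extend to [m] without showing that [m] lies in the cell. *)
Lemma affine_mean_ge0 (a b : R) :
  (forall w, W w -> 0 <= a * X w + b) -> 0 <= a * m + b.
Proof.
move=> ab0; have : 0 <= \int[P]_(w in W) (a * X w + b) by exact: Rintegral_ge0.
rewrite RintegralD//; last 2 first.
- exact: (integrableZl mW a iX).
- exact: finite_measure_integrable_cst.
by rewrite RintegralZl// Rintegral_cst// mE mulrA -mulrDl pmulr_lge0.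
Qed.

Lemma fine_cell_hinge_gap (gamma delta s : R) (A : set R) :
  0 < gamma -> 0 < delta -> 0 <= s -> fine_cell gamma delta A ->
  (forall w, 0 <= X w) -> (forall w, W w -> A (X w)) ->
  exists k : R, forall w, W w ->
    `|hinge s (X w) - hinge s m - k * (X w - m)| <=
    gap_bound gamma delta s (X w) / 2.
Proof.
move=> g0 d0 s0 [c cA] X0 WA.
have h1 x : 0 <= hinge (1 : R) x /\ 0 <= hinge 1 x + (x - 1).
  split; first exact: hinge_ge0.
  rewrite /hinge mul1r; case: (leP (1 - x) 0) => ?; lra.
case: cA => cA.
  exists (- (s / 2)) => w Ww; have Aw := WA _ Ww.
  (* With [w] fixed, [|X w - X v| <= c] is a pair of inequalities affine in [X v]; averaging over
     [v] replaces [X v] by [m]. *)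
  have xm : `|X w - m| <= c.
    rewrite ler_norml; apply/andP; split.
      have := affine_mean_ge0 (a := -1) (b := X w + c); rewrite mulN1r.
      suff : forall v, W v -> 0 <= -1 * X v + (X w + c) by move=> h /(_ h); lra.
      move=> v /WA Av; have [_ _] := cA _ _ Aw Av.
      by rewrite ler_norml; lra.
    have := affine_mean_ge0 (a := 1) (b := c - X w); rewrite mul1r.
    suff : forall v, W v -> 0 <= 1 * X v + (c - X w) by move=> h /(_ h); lra.
    move=> v /WA Av; have [_ _] := cA _ _ Aw Av.
    by rewrite ler_norml; lra.
  apply: le_trans (hinge_gap s0 xm) _.
  rewrite ler_pM2r ?invr_gt0// /gap_bound.
  have [x1 cx _] := cA _ _ Aw Aw.
  have [h10 h20] := h1 (X w).
  rewrite ler_wpDr//.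
    by rewrite addr_ge0// mulr_ge0// ltW.
  rewrite ler_wpM2l//; apply: le_trans cx _.
  by rewrite lerD2l ler_pM2l// /hinge mul1r le_max lexx.
have m0 w : W w -> 0 < m.
  move=> Ww; have := affine_mean_ge0 (a := 1) (b := -1); rewrite mul1r.
  suff : forall v, W v -> 0 <= 1 * X v + -1 by move=> h /(_ h); lra.
  by move=> v /WA Av; have [] := cA _ _ Av Av; lra.
exists ((`|1 - s * m| / m - s) / 2) => w Ww; have Aw := WA _ Ww.
(* The bound [c * X w * X v] is still affine in [X v], so averaging over [v] works as below 1. *)
have xm : `|X w - m| <= c * X w * m.
  rewrite ler_norml; apply/andP; split.
    have := affine_mean_ge0 (a := c * X w - 1) (b := X w).
    suff : forall v, W v -> 0 <= (c * X w - 1) * X v + X w.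
      by move=> h /(_ h); lra.
    move=> v /WA Av; have [_ _] := cA _ _ Aw Av.
    by rewrite ler_norml; lra.
  have := affine_mean_ge0 (a := c * X w + 1) (b := - X w).
  suff : forall v, W v -> 0 <= (c * X w + 1) * X v - X w.
    by move=> h /(_ h); lra.
  move=> v /WA Av; have [_ _] := cA _ _ Aw Av.
  by rewrite ler_norml; lra.
apply: le_trans (hinge_gap_inv s (X0 w) (m0 _ Ww) xm) _.
rewrite ler_pM2r ?invr_gt0// /gap_bound.
have [x1 cx _] := cA _ _ Aw Aw.
have [h10 h20] := h1 (X w).
rewrite ler_wpDl//.
  by rewrite mulr_ge0// addr_ge0// ?mulr_ge0// ltW.
by apply: le_trans cx _; rewrite lerD2l ler_pM2l//; lra.
Qed.

End cell.

(** * Integrals of hinges, on one cell and over all fibers *)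

Section hinge_integral.
Context (R : realType) (d : measure_display) (T : measurableType d)
  (P : probability T R).

Lemma measurable_hinge (s : R) (X : T -> R) : measurable_fun setT X ->
  measurable_fun setT (fun w => hinge s (X w)).
Proof.
move=> mX; apply: measurable_maxr => //; apply: measurable_funB => //.
exact: measurable_funM.
Qed.

Lemma integrable_hinge (s : R) (X : T -> R) :
  P.-integrable setT (EFin \o X) ->
  P.-integrable setT (EFin \o (fun w => hinge s (X w))).
Proof.
move=> iX.
have mX : measurable_fun setT X by exact/measurable_EFinP/(measurable_int P).
have ib : P.-integrable setT (EFin \o (fun w => 1 + `|s| * `|X w|)).
  apply: (integrableD measurableT (f := EFin \o cst 1)
           (g := EFin \o (fun w => `|s| * `|X w|))).
    exact: finite_measure_integrable_cst.
  apply: (integrableZl measurableT `|s| (f := EFin \o (fun w => `|X w|))).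
  exact: integrable_abse iX.
apply: (le_integrable measurableT _ _ ib).
  exact/measurable_EFinP/measurable_hinge.
move=> w _ /=; rewrite lee_fin (ger0_norm (hinge_ge0 _ _)).
rewrite ger0_norm ?addr_ge0 ?mulr_ge0// /hinge -normrM.
rewrite ge_max addr_ge0 ?normr_ge0// andbT lerD2l.
by rewrite -normrN ler_norm.
Qed.

Lemma integrable_gap_bound (gamma delta s : R) (X : T -> R) :
  P.-integrable setT (EFin \o X) ->
  P.-integrable setT (EFin \o (fun w => gap_bound gamma delta s (X w))).
Proof.
move=> iX; have ih := integrable_hinge 1 iX.
have icst (r : R) : P.-integrable setT (EFin \o cst r).
  exact: finite_measure_integrable_cst.
apply: (integrableD measurableT (f := EFin \o (fun w => s * (gamma + delta * hinge 1 (X w))))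
  (g := EFin \o (fun w => gamma * X w + delta * (hinge 1 (X w) + (X w - 1))))).
  apply: (integrableZl measurableT s (f := EFin \o (fun w => gamma + delta * hinge 1 (X w)))).
  apply: (integrableD measurableT (f := EFin \o cst gamma)
    (g := EFin \o (fun w => delta * hinge 1 (X w)))) => //.
  exact: (integrableZl measurableT delta ih).
apply: (integrableD measurableT (f := EFin \o (fun w => gamma * X w))
  (g := EFin \o (fun w => delta * (hinge 1 (X w) + (X w - 1))))).
  exact: (integrableZl measurableT gamma iX).
apply: (integrableZl measurableT delta (f := EFin \o (fun w => hinge 1 (X w) + (X w - 1)))).
apply: (integrableD measurableT (f := EFin \o (fun w => hinge 1 (X w)))
  (g := EFin \o (fun w => X w - 1))) => //.
exact: (integrableB measurableT iX (icst 1)).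
Qed.

Lemma Rintegral_gap_bound (gamma delta s : R) (X : T -> R) :
  P.-integrable setT (EFin \o X) ->
  \int[P]_w gap_bound gamma delta s (X w) =
  s * gamma - delta + ((gamma + delta) * \int[P]_w X w +
    (s + 1) * delta * \int[P]_w hinge 1 (X w)).
Proof.
move=> iX; have ih := integrable_hinge 1 iX.
have icst (r : R) : P.-integrable setT (EFin \o cst r).
  exact: finite_measure_integrable_cst.
transitivity (\int[P]_w ((s * gamma - delta) + ((gamma + delta) * X w +
    (s + 1) * delta * hinge 1 (X w)))).
  by apply: eq_Rintegral => w _; rewrite /gap_bound; ring.
have i1 : P.-integrable setT (EFin \o (fun w => (gamma + delta) * X w)).
  exact: (integrableZl measurableT (gamma + delta) iX).
have i2 : P.-integrable setT (EFin \o (fun w => (s + 1) * delta * hinge 1 (X w))).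
  exact: (integrableZl measurableT ((s + 1) * delta) ih).
rewrite RintegralD ?Rintegral_cst//; last 2 first.
- exact: icst.
- exact: (integrableD measurableT i1 i2).
have P1 : fine (P setT) = 1 by rewrite probability_setT.
by rewrite RintegralD// !RintegralZl// [fine _]P1 mulr1.
Qed.

Lemma integral_hinge_cell_gap (W : set T) (gamma delta s : R) (A : set R)
    (X Y : T -> R) : measurable W ->
  P.-integrable setT (EFin \o X) -> P.-integrable setT (EFin \o Y) ->
  0 < gamma -> 0 < delta -> 0 <= s -> fine_cell gamma delta A ->
  (forall w, 0 <= X w) -> (forall w, W w -> A (X w)) ->
  (forall v w, W v -> W w -> Y v = Y w) ->
  \int[P]_(w in W) Y w = \int[P]_(w in W) X w ->
  `|\int[P]_(w in W) hinge s (X w) - \int[P]_(w in W) hinge s (Y w)| <=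
  \int[P]_(w in W) (gap_bound gamma delta s (X w) / 2).
Proof.
move=> mW iX iY g0 d0 s0 fA X0 XA Yc YX.
have iW f : P.-integrable setT (EFin \o f) -> P.-integrable W (EFin \o f).
  exact: integrableS.
have ib : P.-integrable setT (EFin \o (fun w => gap_bound gamma delta s (X w) / 2)).
  exact: (integrableZr measurableT 2^-1 (integrable_gap_bound _ _ _ iX)).
(* A null cell has no mean value, but all integrals over it vanish. *)
have [PW0|PW0] := eqVneq (P W) 0%E.
  have int0 f : P.-integrable setT (EFin \o f) -> \int[P]_(w in W) f w = 0.
    move=> /iW /measurable_int mf.
    by rewrite /Rintegral null_set_integral.
  rewrite !int0 ?subrr ?normr0//; exact: integrable_hinge.
have [w0 Ww0] : W !=set0.
  by apply/set0P/eqP => We; move: PW0; rewrite We measure0 eqxx.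
have fPW : P W \is a fin_num by exact: fin_num_measure.
have W0 : 0 < fine (P W).
  by rewrite fine_gt0// lt0e PW0 measure_ge0 -ge0_fin_numE.
have YE w : W w -> Y w = Y w0 by move=> Ww; exact: Yc.
(* The constant value of [Y] on [W] is the mean of [X] there. *)
have mE : \int[P]_(w in W) X w = Y w0 * fine (P W).
  rewrite -YX -Rintegral_cst//; apply: eq_Rintegral => w.
  by rewrite inE => /YE.
have [k kgap] := fine_cell_hinge_gap mW (iW _ iX) W0 mE g0 d0 s0 fA X0 XA.
have ihX := iW _ (integrable_hinge s iX).
have ihY := iW _ (integrable_hinge s iY).
have ihXY := integrableB mW ihX ihY.
have iXY := integrableB mW (iW _ iX) (iW _ iY).
have ikXY := integrableZl mW k iXY.
(* The term [k * (X w - Y w)] integrates to 0 over [W], so it can be inserted for free and the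
   pointwise bound applies. *)
have -> : \int[P]_(w in W) hinge s (X w) - \int[P]_(w in W) hinge s (Y w) =
  \int[P]_(w in W) (hinge s (X w) - hinge s (Y w) - k * (X w - Y w)).
  rewrite RintegralB// RintegralB// RintegralZl// RintegralB ?iW//.
  by rewrite YX subrr mulr0 subr0.
have id : P.-integrable W
    (EFin \o (fun w => hinge s (X w) - hinge s (Y w) - k * (X w - Y w))).
  exact: (integrableB mW ihXY ikXY).
apply: le_trans (le_normr_Rintegral mW id) _.
apply: le_Rintegral => //.
- exact: integrable_abse id.
- exact: iW.
- by move=> w Ww; rewrite (YE _ Ww) kgap.
Qed.

Lemma Rintegral_fibers (I : choiceType) (c : T -> I) (s : seq I) (f : T -> R) :
  (forall i, measurable (c @^-1` [set i])) ->
  uniq s -> (forall w, c w \in s) -> P.-integrable setT (EFin \o f) ->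
  \int[P]_w f w = \sum_(i <- s) \int[P]_(w in c @^-1` [set i]) f w.
Proof.
move=> mc us cs fi.
have UT : setT = \big[setU/set0]_(i <- s) (c @^-1` [set i]).
  rewrite -bigcup_seq; apply/seteqP; split => // w _.
  by exists (c w) => //=; exact: cs.
rewrite [in LHS]/Rintegral [in LHS]UT integral_bigsetU_EFin//.
- rewrite -sum_fine// => i _; apply: integrable_fin_num => //.
  exact: integrableS fi.
- by move=> i j _ _ [w [/= <- <-]].
- by rewrite -UT; exact: measurable_int fi.
Qed.

End hinge_integral.

(** * Valid ratios and the hinge gap of a discretization *)

Lemma valid_ratio_integrable (R : realType) (d : measure_display)
    (T : measurableType d) (P : probability T R) (X : T -> R) :
  valid_ratio P X -> P.-integrable setT (EFin \o X).
Proof.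
move=> [mX X0 EX]; apply/integrableP; split; first exact/measurable_EFinP.
under eq_integral do rewrite gee0_abs ?lee_fin//.
by move: EX; rewrite unlock => /le_lt_trans; apply; rewrite ltry.
Qed.

Lemma valid_ratio_Rintegral_le1 (R : realType) (d : measure_display)
    (T : measurableType d) (P : probability T R) (X : T -> R) :
  valid_ratio P X -> \int[P]_w X w <= 1.
Proof.
move=> hX; have iX := valid_ratio_integrable hX; case: hX => _ _.
by rewrite unlock -lee_fin fineK// integrable_fin_num.
Qed.

(** The level set of [Y] through [v] belongs to the sigma-algebra of [c], hence is a preimage under
    [c] and contains the whole fiber of [v]. *)
Lemma cond_expectation_discrete_const (R : realType) (d : measure_display)
    (T : measurableType d) (P : probability T R) (U : Type) (c : T -> U)
    (X Y : T -> R) : is_cond_expectation P (sigma_discrete c) X Y ->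
  forall v w, c v = c w -> Y v = Y w.
Proof.
move=> [mY _ _] v w cvw.
have [|B _ BE] := mY (Y @^-1` [set Y v]).
  by exists [set Y v]; rewrite ?setTI.
suff : (Y @^-1` [set Y v]) w by [].
rewrite -BE; split => //; rewrite /preimage/= -cvw.
by have : (Y @^-1` [set Y v]) v by []; rewrite -BE => -[].
Qed.

Lemma discretization_hinge_gap (R : realType) (gamma delta : R)
    (d : measure_display) (T : measurableType d) (P : probability T R)
    (X Y : T -> R) (s : R) : 0 < gamma < 1 -> 0 < delta < 1 ->
  valid_ratio P X -> is_discretization gamma delta P X Y -> 0 <= s ->
  `|\int[P]_w hinge s (X w) - \int[P]_w hinge s (Y w)| <=
  (s + 1) / 2 * (gamma + delta * \int[P]_w hinge 1 (X w)).
Proof.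
move=> hg hd hX hY s0.
have [/andP[g0 g1] /andP[d0 d1]] := (hg, hd).
have iX := valid_ratio_integrable hX.
have EX1 := valid_ratio_Rintegral_le1 hX.
have Yc := cond_expectation_discrete_const hY.
case: hX => mX X0 _; case: hY => _ iY YX.
pose c w := part_cell gamma delta (X w).
have cP w A : c w = A <-> part gamma delta A /\ A (X w).
  exact: part_cellP hg hd _ _ (X0 w).
have mc A : measurable (c @^-1` [set A]).
  have [pA|pA] := pselect (part gamma delta A).
    rewrite (_ : _ @^-1` _ = [set: T] `&` X @^-1` A).
      exact: (mX measurableT _ (measurable_part pA)).
    rewrite setTI; apply/seteqP; split => w /=; first by case/cP.
    by move=> Aw; apply/cP.
  rewrite (_ : _ @^-1` _ = set0); first exact: measurable0.
  by apply/seteqP; split => w //= /cP[].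
have cs w : c w \in part_seq gamma delta.
  by apply: part_seqP; have /cP[] := erefl (c w).
have us : uniq (part_seq gamma delta) by exact: undup_uniq.
have ib : P.-integrable setT
    (EFin \o (fun w => gap_bound gamma delta s (X w) / 2)).
  exact: (integrableZr measurableT 2^-1 (integrable_gap_bound _ _ _ iX)).
apply: (@le_trans _ _ (\int[P]_w (gap_bound gamma delta s (X w) / 2))).
  have ihX := integrable_hinge s iX; have ihY := integrable_hinge s iY.
  rewrite !(Rintegral_fibers mc us cs)//.
  rewrite -sumrB; apply: le_trans (ler_norm_sum _ _ _) _.
  apply: ler_sum => A _.
  (* A set that is not a cell has an empty fiber and contributes 0. *)
  have [pA|pA] := pselect (part gamma delta A); last first.
    rewrite (_ : _ @^-1` _ = set0).
      by rewrite !Rintegral_set0 subrr normr0.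
    by apply/seteqP; split => w //= /cP[].
  apply: (@integral_hinge_cell_gap _ _ _ _ _ _ _ _ A) => //.
  - exact: part_fine.
  - by move=> w /= /cP[].
  - by move=> v w /= cv cw; apply: Yc; rewrite -/(c v) -/(c w) cv cw.
  - rewrite /Rintegral YX//.
    by exists [set A]; rewrite ?setTI.
rewrite RintegralZr//; last exact: integrable_gap_bound.
rewrite Rintegral_gap_bound//.
move: EX1; set e := \int[P]_w X w; set h := \int[P]_w _ => e1.
(* Here [E[X] <= 1] enters: the summand [delta] cancels against [- delta], leaving
   [(s + 1) * (gamma + delta * h)] before halving. *)
have : (gamma + delta) * e <= gamma + delta by rewrite ler_piMr// addr_ge0// ltW.
lra.
Qed.

(** * Total variation of a product as an iterated integral *)

Section TV_indep_prod.
Context (R : realType) (d1 d2 : measure_display) (T1 : measurableType d1)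
  (T2 : measurableType d2) (Q : probability T1 R) (P : probability T2 R)
  (S : T1 -> R) (X : T2 -> R).
Hypotheses (mS : measurable_fun setT S) (iX : P.-integrable setT (EFin \o X)).

Let f (z : T1 * T2) : \bar R := (hinge (S z.1) (X z.2))%:E.

Let mf : measurable_fun setT f.
Proof.
have mX : measurable_fun setT X by exact/measurable_EFinP/(measurable_int P).
apply/measurable_EFinP; apply: measurable_maxr => //.
apply: measurable_funB => //; apply: measurable_funM.
  exact: measurableT_comp mS measurable_fst.
exact: measurableT_comp mX measurable_snd.
Qed.

Let f0 z : (0 <= f z)%E.
Proof. by rewrite lee_fin hinge_ge0. Qed.

Let fubini_FE q : fubini_F P f q = (\int[P]_w hinge (S q) (X w))%:E.
Proof.
by rewrite /Rintegral fineK// integrable_fin_num//; exact: integrable_hinge.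
Qed.

Lemma measurable_Rintegral_hinge :
  measurable_fun setT (fun q => \int[P]_w hinge (S q) (X w)).
Proof.
apply/measurable_EFinP.
rewrite (_ : _ \o _ = fubini_F P f); last by apply/funext => q; rewrite fubini_FE.
exact: measurable_fun_fubini_tonelli_F.
Qed.

(** Tonelli applies as the hinge is non-negative; integrability of [X] makes the inner integrals
    real numbers. *)
Lemma TV_indep_prodE : TV (Q \x P)%E (indep_prod S X) =
  (\int[Q]_q (\int[P]_w hinge (S q) (X w))%:E)%E.
Proof.
rewrite /TV unlock.
transitivity (\int[(Q \x P)%E]_z f z)%E; first by [].
by rewrite fubini_tonelli1//; apply: eq_integral => q _; rewrite fubini_FE.
Qed.

End TV_indep_prod.

(** * Integration over the law of [S] *)

Theorem theorem5 (R : realType) (gamma delta : R)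
    (hgamma : 0 < gamma < 1) (hdelta : 0 < delta < 1)
    (d : measure_display) (T : measurableType d) (P : probability T R)
    (X : T -> R) (hX : valid_ratio P X)
    (Xt : T -> R) (hXt : is_discretization gamma delta P X Xt) :
  (ext P X P Xt <= gamma%:E + delta%:E * TV P X)%E.
Proof.
have [/andP[g0 g1] /andP[d0 d1]] := (hgamma, hdelta).
have iX := valid_ratio_integrable hX.
have iXt : P.-integrable setT (EFin \o Xt) by case: hXt.
have TVE : TV P X = (\int[P]_w hinge 1 (X w))%:E.
  rewrite /TV unlock fineK; last exact/integrable_fin_num/integrable_hinge.
  by apply: eq_integral => w _; rewrite /hinge mul1r.
pose C := gamma + delta * \int[P]_w hinge 1 (X w).
have C0 : 0 <= C.
  rewrite addr_ge0 ?mulr_ge0 ?(ltW g0) ?(ltW d0)//.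
  by apply: Rintegral_ge0 => w _; exact: hinge_ge0.
rewrite TVE -EFinM -EFinD -/C.
apply: ge_ereal_sup => _ [dS [TS [Q [S [hS ->]]]]].
have iS := valid_ratio_integrable hS.
have ES1 := valid_ratio_Rintegral_le1 hS.
case: hS => mS S0 _.
rewrite !TV_indep_prodE//.
set F := fun q => \int[P]_w hinge (S q) (X w).
set Ft := fun q => \int[P]_w hinge (S q) (Xt w).
have mF : measurable_fun setT F by exact: measurable_Rintegral_hinge.
have mFt : measurable_fun setT Ft by exact: measurable_Rintegral_hinge.
have gapF q : `|F q - Ft q| <= C / 2 * (S q + 1).
  have -> : C / 2 * (S q + 1) = (S q + 1) / 2 * C by field.
  exact: discretization_hinge_gap.
have iB : Q.-integrable setT (EFin \o (fun q => C / 2 * (S q + 1))).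
  apply: (integrableZl measurableT (C / 2) (f := EFin \o (fun q => S q + 1))).
  apply: (integrableD measurableT iS (g := EFin \o cst 1)).
  exact: finite_measure_integrable_cst.
(* Since [S] and [X] are non-negative, each hinge lies in [[0, 1]], and so does [F]. *)
have iF : Q.-integrable setT (EFin \o F).
  apply: (le_integrable measurableT (g := EFin \o cst 1)).
  - exact/measurable_EFinP.
  - move=> q _ /=; rewrite lee_fin normr1 ger0_norm; last first.
      by apply: Rintegral_ge0 => w _; exact: hinge_ge0.
    have P1 : fine (P setT) = 1 by rewrite probability_setT.
    have <- : \int[P]_w cst 1 w = 1 :> R by rewrite Rintegral_cst// [fine _]P1 mulr1.
    apply: le_Rintegral => //.
    + exact: integrable_hinge.
    + exact: finite_measure_integrable_cst.
    + case: hX => _ X0 _ w _; rewrite /hinge ge_max ler01 andbT.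
      by rewrite lerBlDr lerDl mulr_ge0.
  - exact: finite_measure_integrable_cst.
have iD : Q.-integrable setT (EFin \o (fun q => F q - Ft q)).
  apply: (le_integrable measurableT _ _ iB).
    by apply/measurable_EFinP; exact: measurable_funB.
  move=> q _ /=; rewrite lee_fin; apply: le_trans (gapF q) _; exact: ler_norm.
(* A version [Xt] may be negative on null cells, so the pointwise bound by 1 is not at hand; [Ft] is
   recovered as [F - (F - Ft)]. *)
have iFt : Q.-integrable setT (EFin \o Ft).
  have := integrableB measurableT iF iD; apply: eq_integrable => // q _ /=.
  by rewrite -EFinB subKr.
rewrite -integralB_EFin//.
rewrite -EFin_normr_Rintegral// lee_fin.
apply: le_trans (le_normr_Rintegral measurableT iD) _.
apply: (@le_trans _ _ (\int[Q]_q (C / 2 * (S q + 1)))).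
  by apply: le_Rintegral => //; exact: integrable_abse iD.
have Q1 : fine (Q setT) = 1 by rewrite probability_setT.
rewrite RintegralZl//; last first.
  apply: (integrableD measurableT iS (g := EFin \o cst 1)).
  exact: finite_measure_integrable_cst.
rewrite RintegralD//; last exact: finite_measure_integrable_cst.
rewrite Rintegral_cst// [fine _]Q1 mulr1.
(* As [E[S] <= 1], the bound [C / 2 * (E[S] + 1)] is at most [C]. *)
have : C * (\int[Q]_q S q) <= C by rewrite ler_piMr.
lra.
Qed.
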